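(* Let $K\subset\mathbb{C}$ be a field, let $\ell$ be a prime such that $K$ contains all $\ell$-th roots of unity, and let $A\in K$ be such that $r^{\ell}-A$ is irreducible over $K$, with roots $\rho_0,\dots,\rho_{\ell-1}\in\mathbb{C}$. Let $p(x)\in K[x]$ be a polynomial with distinct roots, let $V$ be a resolvent of $p$ with coefficients in $K$, and let $q$ be a monic irreducible factor over $K$ of the corresponding auxiliary polynomial of $p$. Suppose that $q$ becomes reducible over $K(\rho_0)$. Then $q$ splits over $K(\rho_0)$ into exactly $\ell$ irreducible factors, which are pairwise distinct. More precisely, there is a two-variable polynomial $f(X,r)$ with coefficients in $K$ such that each $f(X,\rho_i)$ is irreducible over $K(\rho_0)$, these $\ell$ polynomials are pairwise distinct, and $$q(X)=f(X,\rho_0)\,f(X,\rho_1)\cdots f(X,\rho_{\ell-1}).$$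
   Context: Let $p$ have distinct roots $r_1,\dots,r_n\in\mathbb{C}$. A resolvent of $p$ with coefficients in $K$ is an expression $V(r_1,\dots,r_n)=a_1r_1+\dots+a_nr_n$ with $a_i\in K$ such that the $n!$ values $V(r_{\sigma(1)},\dots,r_{\sigma(n)})$, $\sigma\in S_n$, are pairwise distinct. The corresponding auxiliary polynomial is $\prod_{\sigma\in S_n}\bigl(X-V(r_{\sigma(1)},\dots,r_{\sigma(n)})\bigr)$, which has coefficients in $K$. *)

(* Defs.v *)
From HB Require Import structures.
From mathcomp Require Import all_boot all_order all_algebra all_fingroup.
From mathcomp Require Import boolp reals complex.

Set Implicit Arguments.
Unset Strict Implicit.
Unset Printing Implicit Defensive.

Import GRing.Theory.
Local Open Scope ring_scope.

(* A subfield of C is a predicate K : divringClosed C, and a polynomial over K *)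
(* is a p : {poly C} with p \is a polyOver K.                                  *)

Section Subfields.
Variable C : fieldType.
Implicit Types K F : divringClosed C.

Record subfield K := Subfield { subfield_val : C; _ : subfield_val \in K }.

HB.instance Definition _ K := [isSub for @subfield_val K].
HB.instance Definition _ K := [Choice of subfield K by <:].
HB.instance Definition _ K :=
  [SubChoice_isSubIntegralDomain of subfield K by <:].
HB.instance Definition _ K := [SubIntegralDomain_isSubField of subfield K by <:].

(* K(x), as the intersection of all the subfields of C containing K and x.     *)
Definition adjoin K (x : C) : {pred C} :=
  fun y => `[< forall F, {subset K <= F} -> x \in F -> y \in F >].

Fact adjoin_divring_closed K x : divring_closed (adjoin K x).
Proof.
split; rewrite ?unfold_in /=.
- by apply/asboolP => F _ _; exact: rpred1.
- move=> u v /asboolP Ku /asboolP Kv; apply/asboolP => F KF Fx.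
  by apply: rpredB; [exact: Ku | exact: Kv].
- move=> u v /asboolP Ku /asboolP Kv; apply/asboolP => F KF Fx.
  by apply: rpred_div; [exact: Ku | exact: Kv].
Qed.

HB.instance Definition _ K x :=
  GRing.isDivringClosed.Build C (adjoin K x) (adjoin_divring_closed K x).

Definition irreducible_over F (q : {poly C}) : Prop :=
  exists2 q' : {poly subfield F}, map_poly val q' = q & irreducible_poly q'.

End Subfields.

Section Resolvent.
Variables (C : fieldType) (n : nat).
Implicit Types a r : 'I_n -> C.

Definition resolvent_val a r (s : 'S_n) : C := \sum_(i < n) a i * r (s i).

Definition is_resolvent (K : {pred C}) a r : Prop :=
  (forall i, a i \in K) /\ injective (resolvent_val a r).

Definition auxiliary_poly a r : {poly C} :=
  \prod_(s : 'S_n) ('X - (resolvent_val a r s)%:P).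

End Resolvent.

(* Main.v *)
(* Write L = K(rho_0). Since K contains a primitive l-th root of unity w,      *)
(* rho_0 |-> w rho_0 extends to an automorphism t of L over K with t^l = 1 and *)
(* fixed field K. Let g be a monic irreducible factor of q over L. The product *)
(* of the conjugates g, t g, ..., t^(l-1) g is fixed by t, so lies in K[X]; as *)
(* l is prime, either t g = g, whence g = q, or these conjugates are pairwise  *)
(* distinct, hence coprime, and their product divides q, hence is q. Writing   *)
(* the coefficients of g as polynomials in rho_0 over K gives f, and           *)
(* t^i g = f(X, w^i rho_0).                                                    *)

Require Import Defs.
From HB Require Import structures.
From mathcomp Require Import all_boot all_order all_algebra all_fingroup.
From mathcomp Require Import boolp reals complex.
From mathcomp Require Import cyclic separable.

Set Implicit Arguments.
Unset Strict Implicit.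
Unset Printing Implicit Defensive.

Import GRing.Theory.
Local Open Scope ring_scope.

(** This is Galois descent along the cyclic group generated by [t], kept elementary. Every element
    of L is [h(rho_0)] for some [h] over K, and [t] sends it to [h(w rho_0)]
    ([conjugation_morphism], [radical_automorphism]). If [t] fixes it, then [h] minus a constant has
    l distinct roots but degree below l, so the element lies in K ([radical_automorphism_fixed]).
    The orbit argument itself only uses that [t^l] is the identity and that q has no proper
    [t]-invariant factor; [uniq_orbit_map_poly] and [prod_orbit_map_poly] carry it, and
    [radical_extension_factorization] joins the two halves. *)

(** * Monic irreducible factors over an arbitrary field *)

Section IrreducibleFactors.
Variable E : fieldType.
Implicit Types (p q d g : {poly E}) (s : seq {poly E}).

Lemma irreducible_poly_eqp p q :
  p %= q -> irreducible_poly p -> irreducible_poly q.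
Proof.
move=> pq [p_gt1 irr_p]; split=> [|d d1 dq]; first by rewrite -(eqp_size pq).
by apply: (eqp_trans (irr_p d d1 _) pq); rewrite (eqp_dvdr _ pq).
Qed.

Lemma irreducible_monic_factor q : (1 < size q)%N ->
  exists g, [/\ g \is monic, irreducible_poly g & g %| q].
Proof.
have [m] := ubnP (size q); elim: m q => // m IHm q leqm q_gt1.
have q0 : q != 0 by rewrite -size_poly_gt0 (ltn_trans _ q_gt1).
have lq0 : (lead_coef q)^-1 != 0 by rewrite invr_eq0 lead_coef_eq0.
have [irr_q | nirr_q] := pselect (irreducible_poly q).
  exists ((lead_coef q)^-1 *: q); split.
  - by rewrite monicE lead_coefZ mulVf ?lead_coef_eq0.
  - by apply: irreducible_poly_eqp irr_q; rewrite eqp_sym eqp_scale.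
  - by rewrite dvdpZl.
have [d [d1 dq ndq]] : exists d, [/\ size d != 1, d %| q & ~~ (d %= q)].
  apply: contrapT => nd; apply: nirr_q; split=> // d d1 dq.
  by apply: contrapT => ndq; apply: nd; exists d; split=> //; apply/negP.
have d0 : d != 0 by apply: contraNneq q0 => d0; rewrite d0 dvd0p in dq.
have [||g [mg ig gd]] := IHm d.
- apply: (leq_trans _ (leqm : (size q <= m)%N)).
  by rewrite ltn_neqAle dvdp_leq // andbT dvdp_size_eqp.
- by rewrite ltn_neqAle eq_sym d1 size_poly_gt0.
by exists g; split=> //; apply: dvdp_trans gd dq.
Qed.

Lemma coprimep_monic_irreducible p q : p \is monic -> q \is monic ->
  irreducible_poly p -> irreducible_poly q -> p != q -> coprimep p q.
Proof.
move=> mp mq ip iq npq; rewrite irreducible_poly_coprime //.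
apply: contra npq => pq; rewrite -eqp_monic //.
by apply: iq.2 pq; rewrite neq_ltn ip.1 orbT.
Qed.

(** Distinct monic irreducible polynomials are coprime, so divisors accumulate by Gauss's lemma. *)
Lemma dvdp_prod_monic_irreducible s q : uniq s ->
  (forall g, g \in s -> [/\ g \is monic, irreducible_poly g & g %| q]) ->
  \prod_(g <- s) g %| q.
Proof.
elim: s => [|g s IHs] /=; first by rewrite big_nil dvd1p.
move=> /andP[gs us] sP; have [mg ig gq] := sP g (mem_head _ _).
have {}sP h : h \in s -> [/\ h \is monic, irreducible_poly h & h %| q].
  by move=> hs; apply: (sP h); rewrite inE hs orbT.
rewrite big_cons Gauss_dvdp ?gq ?IHs //.
rewrite big_seq; apply: (big_ind (coprimep g)) => [|x y cx cy|h hs].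
- exact: coprimep1.
- by rewrite coprimepMr cx.
have [mh ih _] := sP h hs; apply: coprimep_monic_irreducible => //.
by apply: contraNneq gs => ->.
Qed.

End IrreducibleFactors.

(** * The orbit of an irreducible factor under a field automorphism of prime order *)

Section CyclicOrbit.
Variables (E : fieldType) (t : {rmorphism E -> E}) (l : nat).
Hypotheses (l_prime : prime l) (tl : iter l t =1 id).
Local Notation T := (map_poly t).

Lemma coef_iter_map_poly i (p : {poly E}) j : (iter i T p)`_j = iter i t p`_j.
Proof. by elim: i => //= i IHi; rewrite coef_map IHi. Qed.

Lemma iter_map_poly_order (p : {poly E}) : iter l T p = p.
Proof. by apply/polyP=> j; rewrite coef_iter_map_poly tl. Qed.

(** [T] is bijective with inverse [T^(l-1)], so each divisor of [T g] is the image of a divisor of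
    [g]. *)
Lemma irreducible_map_poly (g : {poly E}) :
  irreducible_poly g -> irreducible_poly (T g).
Proof.
move=> [g_gt1 irr_g]; split=> [|d]; first by rewrite size_map_poly.
have -> : d = T (iter l.-1 T d).
  by rewrite -iterS prednK ?prime_gt0 // iter_map_poly_order.
by rewrite size_map_poly dvdp_map eqp_map; exact: irr_g.
Qed.

Variables q g : {poly E}.
Hypotheses (q_monic : q \is monic) (Tq : T q = q).
(** This encodes irreducibility of [q] over the fixed field of [t] without introducing that
    field. *)
Hypothesis q_irr :
  forall d : {poly E}, T d = d -> size d != 1 -> d %| q -> d %= q.
Hypotheses (g_monic : g \is monic) (g_irr : irreducible_poly g).
Hypotheses (gq : g %| q) (g_neq : g != q).

Lemma monic_iter_map_poly i : iter i T g \is monic.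
Proof. by elim: i => //= i IHi; apply: monic_map. Qed.

Lemma irreducible_iter_map_poly i : irreducible_poly (iter i T g).
Proof. by elim: i => //= i IHi; apply: irreducible_map_poly. Qed.

Lemma dvdp_iter_map_poly i : iter i T g %| q.
Proof. by elim: i => //= i IHi; rewrite -Tq dvdp_map. Qed.

Lemma map_poly_irreducible_factor_neq : T g != g.
Proof.
apply: contra g_neq => /eqP Tg; rewrite -eqp_monic //.
by apply: q_irr => //; rewrite neq_ltn g_irr.1 orbT.
Qed.

(* Such an m is coprime to the prime l, so T^m g = g would force T g = g. *)
Lemma iter_map_poly_period m : (0 < m < l)%N -> iter m T g != g.
Proof.
case/andP=> m_gt0 ltml; apply/negP => /eqP Tm.
have iterM a b : iter b T g = g -> iter (a * b) T g = g.
  by move=> Tb; elim: a => //= a IHa; rewrite mulSn iterD IHa.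
have /eqP cml : coprime m l.
  by rewrite coprime_sym prime_coprime // gtnNdvd.
have [u v def_u _] := egcdnP l m_gt0.
have := iterM u m Tm.
rewrite def_u cml addn1 iterS iterM ?iter_map_poly_order //.
by apply/eqP/map_poly_irreducible_factor_neq.
Qed.

(** [T] is injective, so a coincidence between exponents i < j cancels down to a period j - i of
    [g], strictly between 0 and l. *)
Lemma uniq_orbit_map_poly : uniq [seq iter i T g | i <- iota 0 l].
Proof.
rewrite map_inj_in_uniq ?iota_uniq // => i j; rewrite !mem_iota /= !add0n.
wlog ltij : i j / (i < j)%N => [IH | il jl].
  case: (ltngtP i j) => // [ij|ji] il jl Tij; first exact: IH Tij.
  by apply/esym/(IH j i).
have ji_lt : (0 < j - i < l)%N.
  by rewrite subn_gt0 ltij (leq_ltn_trans (leq_subr _ _) jl).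
rewrite -{1}(subnKC (ltnW ltij)) iterD.
move: (j - i)%N ji_lt => m /iter_map_poly_period/eqP Tm Tij.
by case: Tm; elim: i Tij {il ltij} => //= k IHk /map_poly_inj/IHk.
Qed.

Lemma prod_orbit_map_poly : q = \prod_(i <- iota 0 l) iter i T g.
Proof.
(* Applying [T] shifts the factors cyclically, because [T^l g = g]. *)
set P := RHS; have TP : T P = P.
  rewrite /P -[l](prednK (prime_gt0 l_prime)) -[iota _ _]/(index_iota 0 _.+1).
  rewrite rmorph_prod big_nat_recr //= big_nat_recl //= mulrC -iterS.
  by rewrite prednK ?prime_gt0 // iter_map_poly_order.
have mP : P \is monic by apply: monic_prod => i _; apply: monic_iter_map_poly.
apply/eqP; rewrite eq_sym -eqp_monic //; apply: q_irr => //.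
- have gP : g %| P.
    rewrite /P -[l](prednK (prime_gt0 l_prime)) big_cons.
    exact: dvdp_mulr.
  by rewrite neq_ltn (leq_trans g_irr.1 (dvdp_leq _ gP)) ?orbT ?monic_neq0.
rewrite /P -(big_map (fun i => iter i T g) predT id).
apply: (dvdp_prod_monic_irreducible uniq_orbit_map_poly) => _ /mapP[i _ ->].
split; [exact: monic_iter_map_poly | exact: irreducible_iter_map_poly |].
exact: dvdp_iter_map_poly.
Qed.

End CyclicOrbit.

(** * Simple algebraic extensions and conjugation of the generator *)

Section SimpleExtension.
Variables (C : fieldType) (K : divringClosed C).
Implicit Types (h M : {poly subfield K}) (x y z : C).
Local Notation "h ^v" := (map_poly val h)
  (at level 2, format "h ^v") : ring_scope.

Lemma map_val_polyOver h : h^v \is a polyOver K.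
Proof. by apply/polyOverP=> i; rewrite coef_map; case: h`_i. Qed.

Lemma polyOver_map_val (p : {poly C}) :
  p \is a polyOver K -> exists h, h^v = p.
Proof.
move=> /polyOverP Kp; exists (\poly_(i < size p) Sub p`_i (Kp i)).
apply/polyP=> i; rewrite coef_map coef_poly; case: ltnP => //= le_p_i.
by rewrite nth_default.
Qed.

Lemma horner_map_valB h k z : (h - k)^v.[z] = h^v.[z] - k^v.[z].
Proof. by rewrite rmorphB hornerD hornerN. Qed.

Lemma horner_map_valM h k z : (h * k)^v.[z] = h^v.[z] * k^v.[z].
Proof. by rewrite rmorphM hornerM. Qed.

Lemma horner_map_val1 z : (1 : {poly subfield K})^v.[z] = 1.
Proof. by rewrite rmorph1 hornerC. Qed.

(** If [M] does not divide [h], the two are coprime and share no root. Thus [M] acts as the minimal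
    polynomial of [z]. *)
Lemma root_map_val_irreducible M z h : irreducible_poly M -> root M^v z ->
  root h^v z = (M %| h).
Proof.
move=> irrM Mz; apply/idP/idP=> [hz | /dvdpP[u ->]]; last first.
  by rewrite rmorphM rootM Mz orbT.
apply: contraLR hz; rewrite -irreducible_poly_coprime // => coMh.
by apply: (coprimep_root _ Mz); rewrite coprimep_map.
Qed.

Lemma mem_adjoin_sub x : {subset K <= adjoin K x}.
Proof. by move=> y Ky; apply/asboolP => F KF _; apply: KF. Qed.

Lemma mem_adjoin_gen x : x \in adjoin K x.
Proof. by apply/asboolP. Qed.

Section Generator.
Variables (M : {poly subfield K}) (x : C).
Hypotheses (irrM : irreducible_poly M) (Mx : root M^v x).

Definition poly_values : {pred C} := fun y => `[< exists h, h^v.[x] = y >].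

(* Inverses come from a Bezout relation with M. *)
Fact poly_values_divring_closed : divring_closed poly_values.
Proof.
have valuesM u v : u \in poly_values -> v \in poly_values ->
    u * v \in poly_values.
  move=> /asboolP[h <-] /asboolP[k <-]; apply/asboolP; exists (h * k).
  exact: horner_map_valM.
split; first by apply/asboolP; exists 1; exact: horner_map_val1.
  move=> u v /asboolP[h <-] /asboolP[k <-]; apply/asboolP; exists (h - k).
  exact: horner_map_valB.
move=> u v uV vV; apply: valuesM => //; move: vV => /asboolP[h <-].
apply/asboolP.
(* The inverse of 0 is 0 by convention, which is the value of the zero polynomial. *)
have [hx0 | hx0] := eqVneq h^v.[x] 0.
  by exists 0; rewrite hx0 invr0 rmorph0 horner0.
have /Bezout_eq1_coprimepP[[a b] /= ab1] : coprimep M h.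
  by rewrite irreducible_poly_coprime // -(root_map_val_irreducible _ irrM Mx).
exists b; apply: (mulIf hx0); rewrite mulVf //.
have := congr1 (fun k => k^v.[x]) ab1.
rewrite rmorphD !rmorphM rmorph1 hornerD !hornerM hornerC.
by rewrite (rootP Mx) mulr0 add0r.
Qed.

(** K[x] is a field containing K and x, hence one of the subfields whose intersection is
    [adjoin K x]. *)
Lemma adjoin_poly y : y \in adjoin K x -> exists h, h^v.[x] = y.
Proof.
pose F : divringClosed C := HB.pack poly_values
  (GRing.isDivringClosed.Build C poly_values poly_values_divring_closed).
move=> /asboolP/(_ F) yF; apply/asboolP/yF.
- move=> z Kz; apply/asboolP; exists (Sub z Kz)%:P.
  by rewrite map_polyC hornerC.
- by apply/asboolP; exists 'X; rewrite map_polyX hornerX.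
Qed.

Lemma poly_adjoin h z : z \in adjoin K x -> h^v.[z] \in adjoin K x.
Proof.
move=> zL; apply: rpred_horner zL.
by apply: polyOverS (map_val_polyOver h); apply: mem_adjoin_sub.
Qed.

Lemma conjugation_morphism x' : root M^v x' -> x' \in adjoin K x ->
  exists t : {rmorphism subfield (adjoin K x) -> subfield (adjoin K x)},
    forall h (u : subfield (adjoin K x)),
      val u = h^v.[x] -> val (t u) = h^v.[x'].
Proof.
move=> Mx' Lx'.
have repr (y : subfield (adjoin K x)) :
    {h : {poly subfield K} | h^v.[x] = val y}.
  by apply: cid; apply: adjoin_poly; case: y.
pose t (y : subfield (adjoin K x)) : subfield (adjoin K x) :=
  Subfield (poly_adjoin (sval (repr y)) Lx').
(* Independence of the chosen representative: two polynomials agree at [x] iff [M] divides their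
   difference, iff they agree at [x']. The morphism laws then follow by choosing convenient
   representatives. *)
have tE h (u : subfield (adjoin K x)) : val u = h^v.[x] -> val (t u) = h^v.[x'].
  rewrite /=; case: (repr u) => k /= <- /eqP; rewrite -subr_eq0 => /eqP kh.
  apply/eqP; rewrite -subr_eq0 -horner_map_valB -/(root _ _).
  rewrite (root_map_val_irreducible _ irrM Mx').
  rewrite -(root_map_val_irreducible _ irrM Mx).
  by rewrite /root horner_map_valB kh.
have tB : zmod_morphism t.
  move=> u v; apply: val_inj; have [h hu] := repr u; have [k kv] := repr v.
  by rewrite (tE (h - k)) horner_map_valB ?hu ?kv // -(tE h u) // -(tE k v).
have tM : monoid_morphism t.
  split=> [|u v]; apply: val_inj.
    by rewrite (tE 1) horner_map_val1.
  have [h hu] := repr u; have [k kv] := repr v.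
  by rewrite (tE (h * k)) horner_map_valM ?hu ?kv // -(tE h u) // -(tE k v).
pose zt := GRing.isZmodMorphism.Build _ _ t tB.
pose mt := GRing.isMonoidMorphism.Build _ _ t tM.
by exists (HB.pack_for {rmorphism subfield (adjoin K x) -> _} t zt mt).
Qed.

End Generator.
End SimpleExtension.

(** * The roots of X^l - A *)

Lemma separable_XnsubC (E : fieldType) n (a : E) :
  n%:R != 0 :> E -> a != 0 -> separable_poly ('X^n - a%:P).
Proof.
case: n => [/eqP// | n n0 a0]; rewrite unlock derivB derivC subr0 derivXn /=.
(* With N = n + 1, the relation is -(1/a) (X^N - a) + (X/(aN)) N X^(N-1) = 1. *)
apply/Bezout_coprimepP; exists (- a^-1%:P, (a * n.+1%:R)^-1 *: 'X) => /=.
rewrite -scaler_nat -!scalerAl -!scalerAr scalerA -exprS.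
have -> : (a * n.+1%:R)^-1 * n.+1%:R = a^-1 by rewrite invfM mulfVK.
rewrite -mul_polyC mulNr mulrBr opprB -polyCM mulVf // addrAC addrK.
exact: eqpxx.
Qed.

Section RadicalExtension.
Variables (C : fieldType) (K : divringClosed C) (l : nat) (A : C).
Variable rho : l.-tuple C.
Hypotheses (l_prime : prime l) (l_neq0 : l%:R != 0 :> C).
Hypothesis K_unity : forall z : C, l.-unity_root z -> z \in K.
Hypothesis irr_XlA : irreducible_over K ('X^l - A%:P).
Hypothesis rhoE : 'X^l - A%:P = \prod_(z <- rho) ('X - z%:P).
Local Notation x := rho`_0.
Local Notation L := (subfield (adjoin K x)).

Let l_gt0 : (0 < l)%N := prime_gt0 l_prime.

(** Otherwise X would be a proper factor of X^l, since l is at least 2. *)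
Lemma radicand_neq0 : A != 0.
Proof.
have [M MA [_ irrM]] := irr_XlA; apply/eqP => A0.
have {}MA : M = 'X^l.
  by apply: (@map_poly_inj _ _ val); rewrite MA A0 subr0 map_polyXn.
have /eqp_size : 'X %= M.
  by apply: irrM; rewrite ?size_polyX // MA -(prednK l_gt0) exprS dvdp_mulr.
rewrite size_polyX MA size_polyXn; case: l l_prime => [|[|]] //.
Qed.

Lemma mem_radical z : (z \in rho) = (z ^+ l == A).
Proof.
by rewrite -root_prod_XsubC -rhoE rootE !hornerE subr_eq0.
Qed.

Lemma radical_uniq : uniq rho.
Proof.
by rewrite -separable_prod_XsubC -rhoE separable_XnsubC ?radicand_neq0.
Qed.

Lemma radical_gen_mem : x \in rho.
Proof. by rewrite mem_nth ?size_tuple. Qed.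

Lemma radical_gen_neq0 : x != 0.
Proof.
apply: contra radicand_neq0 => /eqP x0; have := radical_gen_mem.
by rewrite mem_radical x0 expr0n gtn_eqF // eq_sym.
Qed.

(** The quotients of the roots by [rho_0] are l distinct l-th roots of unity, and such a full set
    contains a primitive one. *)
Lemma radical_prim_root : exists2 w, l.-primitive_root w & w \in K.
Proof.
have : has l.-primitive_root [seq z / x | z <- rho].
  apply: has_prim_root => //; last by rewrite size_map size_tuple.
    apply/allP => _ /mapP[z zr ->]; apply/unity_rootP.
    move: zr radical_gen_mem; rewrite !mem_radical expr_div_n => /eqP-> /eqP->.
    by rewrite divff ?radicand_neq0.
  rewrite map_inj_uniq ?radical_uniq // => u v; apply: mulIf.
  by rewrite invr_eq0 radical_gen_neq0.
case/hasP=> w _ prim_w; exists w => //.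
by apply: K_unity; apply/unity_rootP; rewrite prim_expr_order.
Qed.

(** Only a permutation can be claimed, since [rho] lists the roots in arbitrary order. The [w^i x]
    are l distinct roots, so they exhaust [rho]. *)
Lemma perm_radical w : l.-primitive_root w ->
  perm_eq rho [seq w ^+ i * x | i <- iota 0 l].
Proof.
move=> prim_w; rewrite perm_sym.
set s := map _ _; have s_uniq : uniq s.
  rewrite map_inj_in_uniq ?iota_uniq // => i j.
  rewrite !mem_iota /= => il jl /(mulIf radical_gen_neq0)/eqP.
  by rewrite (eq_prim_root_expr prim_w) !modn_small // => /eqP.
have s_rho : {subset s <= rho}.
  move=> _ /mapP[i _ ->]; move: radical_gen_mem; rewrite !mem_radical.
  by rewrite exprMn exprAC (prim_expr_order prim_w) expr1n mul1r.
apply: uniq_perm => //; first exact: radical_uniq.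
move=> z; have [|_ -> //] := uniq_min_size s_uniq s_rho.
by rewrite size_map size_iota size_tuple.
Qed.

(** * The automorphism of order l and its fixed field *)

Section Automorphism.
Variables (M : {poly subfield K}) (w : C).
Hypotheses (MA : map_poly val M = 'X^l - A%:P) (irrM : irreducible_poly M).
Hypotheses (prim_w : l.-primitive_root w) (Kw : w \in K).

Lemma root_radical z : root (map_poly val M) z = (z \in rho).
Proof. by rewrite MA rhoE root_prod_XsubC. Qed.

Lemma radical_automorphism : exists t : {rmorphism L -> L},
  forall i (h : {poly subfield K}) (u : L),
    val u = (map_poly val h).[x] ->
    val (iter i t u) = (map_poly val h).[w ^+ i * x].
Proof.
have Mx : root (map_poly val M) x by rewrite root_radical radical_gen_mem.
have Mwx : root (map_poly val M) (w * x).
  rewrite root_radical mem_radical exprMn (prim_expr_order prim_w) mul1r.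
  by rewrite -mem_radical radical_gen_mem.
have Lwx : w * x \in adjoin K x.
  by rewrite rpredM ?mem_adjoin_gen ?mem_adjoin_sub.
have [t tE] := conjugation_morphism irrM Mx Mwx Lwx.
exists t; elim=> [|i IHi] h u hu; first by rewrite expr0 mul1r.
(* As [w] is in K, [h(wX)] is again over K and represents [t u]; the induction hypothesis applies to
   it. *)
have wXE y : (map_poly val (h \Po ((Subfield Kw)%:P * 'X))).[y] =
    (map_poly val h).[w * y].
  rewrite map_comp_poly horner_comp horner_map_valM map_polyC map_polyX.
  by rewrite !hornerE.
rewrite iterSr (IHi (h \Po ((Subfield Kw)%:P * 'X))) wXE.
  by rewrite mulrA -exprS.
exact: tE.
Qed.

Variable t : {rmorphism L -> L}.
Hypothesis tE : forall i (h : {poly subfield K}) (u : L),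
  val u = (map_poly val h).[x] ->
  val (iter i t u) = (map_poly val h).[w ^+ i * x].

(** Reduction modulo [M] gives the size bound, on which the root count for fixed elements relies. *)
Lemma radical_poly (u : L) : exists h : {poly subfield K},
  (size h <= l)%N /\ (map_poly val h).[x] = val u.
Proof.
have Mx : root (map_poly val M) x by rewrite root_radical radical_gen_mem.
have [h hu] := adjoin_poly irrM Mx (valP u : val u \in adjoin K x).
have sM : size M = l.+1.
  by rewrite -(size_map_poly val) MA size_XnsubC.
exists (h %% M); split.
  by rewrite -ltnS -sM ltn_modp -size_poly_eq0 sM.
rewrite -hu {2}(divp_eq h M) rmorphD hornerD horner_map_valM (rootP Mx).
by rewrite mulr0 add0r.
Qed.

Lemma radical_automorphism_order : iter l t =1 id.
Proof.
move=> u; apply: val_inj; have [h [_ hu]] := radical_poly u.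
by rewrite (tE _ (esym hu)) (prim_expr_order prim_w) mul1r hu.
Qed.

Lemma radical_automorphism_fixed (u : L) : t u = u -> val u \in K.
Proof.
move=> tu; have [h [size_h hu]] := radical_poly u.
have hK : map_poly val h = (val u)%:P.
  apply/eqP; rewrite -subr_eq0; apply: contraT => d0.
  (* A nonzero [h - u] would have the l distinct elements of [rho] as roots, while its size is at
     most l. *)
  have /(max_poly_roots d0)/(_ radical_uniq) :
      all (root (map_poly val h - (val u)%:P)) rho.
    apply/allP=> z; rewrite (perm_mem (perm_radical prim_w)) => /mapP[i _ ->].
    rewrite rootE !hornerE -(tE i (esym hu)) subr_eq0.
    by elim: i => //= i /eqP/val_inj->; rewrite tu.
  rewrite size_tuple ltnNge (leq_trans (size_polyD _ _)) // geq_max.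
  by rewrite size_map_poly size_h size_polyN (leq_trans (size_polyC_leq1 _)).
have -> : val u = (map_poly val h)`_0 by rewrite hK coefC.
by apply/polyOverP/map_val_polyOver.
Qed.

End Automorphism.

(** * The factorization of q over K(rho_0) *)

Theorem radical_extension_factorization (q : {poly C}) :
  q \is monic -> irreducible_over K q -> ~ irreducible_over (adjoin K x) q ->
  exists f : {poly {poly C}},
    [/\ f \is a polyOver (polyOver K),
        forall z, z \in rho -> f.[z%:P] \is monic /\
          irreducible_over (adjoin K x) f.[z%:P],
        uniq [seq f.[z%:P] | z <- rho]
      & q = \prod_(z <- rho) f.[z%:P]].
Proof.
move=> q_monic [q' q'E irr_q'] nirr_q.
have [M MA irrM] := irr_XlA; have [w prim_w Kw] := radical_prim_root.
have [t tE] := radical_automorphism MA irrM prim_w Kw.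
have tl := radical_automorphism_order MA irrM prim_w tE.
have [qL qLE] : exists qL : {poly L}, map_poly val qL = q.
  apply: polyOver_map_val; rewrite -q'E.
  by apply: polyOverS (map_val_polyOver q'); apply: mem_adjoin_sub.
have size_q : size q = size q' by rewrite -q'E size_map_poly.
have size_qL : size qL = size q by rewrite -qLE size_map_poly.
have qL_monic : qL \is monic by rewrite -(map_monic val) qLE.
have TqL : map_poly t qL = qL.
  apply/polyP=> i; rewrite coef_map; apply: val_inj.
  have qLi : val qL`_i = (map_poly val (q'`_i)%:P).[x].
    by rewrite map_polyC hornerC -!coef_map qLE q'E.
  by have /= -> := tE 1 _ _ qLi; rewrite qLi map_polyC !hornerC.
(* A [t]-invariant divisor has its coefficients in K, where [q'] is irreducible. *)
have qL_irr d : map_poly t d = d -> size d != 1 -> d %| qL -> d %= qL.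
  move=> Td d1 dq.
  have [d' d'E] :
      exists d' : {poly subfield K}, map_poly val d' = map_poly val d.
    apply: polyOver_map_val; apply/polyOverP => i; rewrite coef_map.
    apply: (radical_automorphism_fixed MA irrM prim_w tE).
    by rewrite -coef_map Td.
  rewrite -(eqp_map val) -d'E qLE -q'E eqp_map; apply: irr_q'.2.
    by rewrite -(size_map_poly val) d'E size_map_poly.
  by rewrite -(dvdp_map val) d'E q'E -qLE dvdp_map.
have [|g [g_monic g_irr gq]] := @irreducible_monic_factor _ qL.
  by rewrite size_qL size_q irr_q'.1.
have g_neq : g != qL.
  by apply: contra_not_neq nirr_q => gqL; exists g => //; rewrite gqL.
have repr (u : L) : {h : {poly subfield K} | (map_poly val h).[x] = val u}.
  by apply: cid; have [h [_ hu]] := radical_poly MA irrM u; exists h.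
(* Each coefficient of [g] is written as a polynomial in [rho_0] over K. In [G] the outer variable
   is X; [swapXY] makes r the outer one, so that evaluation substitutes for r. *)
pose G := \poly_(i < size g) map_poly val (sval (repr g`_i)).
pose f := swapXY G.
have fE i : f.[(w ^+ i * x)%:P] = map_poly val (iter i (map_poly t) g).
  rewrite horner_swapXY; apply/polyP=> j.
  rewrite !coef_map coef_iter_map_poly coef_poly /=; case: ltnP => gj.
    by case: (repr g`_j) => h hg; rewrite (tE i h).
  (* Beyond the size of [g] the coefficient is 0, which [t] preserves. *)
  have -> : iter i t g`_j = 0.
    by rewrite [g`_j]nth_default //; elim: (i) => //= k ->; rewrite rmorph0.
  by rewrite /horner_eval horner0.
have frho : perm_eq [seq f.[z%:P] | z <- rho]
    [seq map_poly val (iter i (map_poly t) g) | i <- iota 0 l].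
  have := perm_map (fun z => f.[z%:P]) (perm_radical prim_w).
  by rewrite -map_comp (eq_map fE).
exists f; split.
- apply/polyOverP=> i; apply/polyOverP=> j; rewrite coef_swapXY coef_poly.
  case: ifP => _; last by rewrite coef0 rpred0.
  exact/polyOverP/map_val_polyOver.
- move=> z zr; have := map_f (fun z => f.[z%:P]) zr.
  rewrite (perm_mem frho) => /mapP[i _ ->]; split.
    by rewrite map_monic monic_iter_map_poly.
  exists (iter i (map_poly t) g) => //.
  by have := irreducible_iter_map_poly l_prime tl g_irr i.
- rewrite (perm_uniq frho) (map_comp (map_poly val)).
  rewrite map_inj_uniq; last exact: map_poly_inj.
  by have := uniq_orbit_map_poly l_prime tl qL_monic qL_irr g_monic g_irr gq
    g_neq.
- rewrite -(big_map (fun z => f.[z%:P]) predT id) (perm_big _ frho) big_map.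
  rewrite -qLE (prod_orbit_map_poly l_prime tl qL_monic TqL qL_irr g_monic g_irr
    gq g_neq).
  exact: rmorph_prod.
Qed.

End RadicalExtension.

(* f : {poly {poly C}} stands for f(X, r), with outer variable r and inner     *)
(* variable X, so that f.[z%:P] is f(X, z).                                    *)
Theorem mainTheorem3 (R : realType) (K : divringClosed R[i])
  (l : nat) (A : R[i]) (rho : l.-tuple R[i])
  (n : nat) (p : {poly R[i]}) (r a : 'I_n -> R[i]) (q : {poly R[i]}) :
  prime l ->
  (forall z : R[i], l.-unity_root z -> z \in K) ->
  A \in K ->
  irreducible_over K ('X^l - A%:P) ->
  'X^l - A%:P = \prod_(z <- rho) ('X - z%:P) ->
  p \is a polyOver K ->
  p != 0 ->
  p = lead_coef p *: \prod_(i < n) ('X - (r i)%:P) ->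
  injective r ->
  is_resolvent K a r ->
  q \is monic ->
  irreducible_over K q ->
  q %| auxiliary_poly a r ->
  ~ irreducible_over (adjoin K rho`_0) q ->
  (exists s : l.-tuple {poly R[i]},
     [/\ forall g, g \in s ->
           g \is monic /\ irreducible_over (adjoin K rho`_0) g,
         uniq s
       & q = \prod_(g <- s) g])
  /\
  (exists f : {poly {poly R[i]}},
     [/\ f \is a polyOver (polyOver K),
         forall i : 'I_l,
           irreducible_over (adjoin K rho`_0) f.[(rho`_i)%:P],
         forall i j : 'I_l,
           f.[(rho`_i)%:P] = f.[(rho`_j)%:P] -> i = j
       & q = \prod_(i < l) f.[(rho`_i)%:P]]).
Proof.
move=> l_prime K_unity _ irr_XlA rhoE _ _ _ _ _ q_monic irr_q _ nirr_q.
(* Characteristic 0 makes X^l - A separable. *)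
have l_neq0 : l%:R != 0 :> R[i] by rewrite Num.Theory.pnatr_eq0 -lt0n prime_gt0.
have [f [fK f_irr f_uniq qE]] := radical_extension_factorization
  l_prime l_neq0 K_unity irr_XlA rhoE q_monic irr_q nirr_q.
have rho_nth (i : 'I_l) : rho`_i \in rho by rewrite mem_nth ?size_tuple.
split.
  exists (map_tuple (fun z => f.[z%:P]) rho); split=> //.
    by move=> _ /mapP[z zr ->]; apply: f_irr.
  by rewrite big_map.
exists f; split=> // [i | i j fij |].
- by apply: (f_irr _ _).2.
- apply/val_inj/eqP.
  rewrite /= -(nth_uniq 0 _ _ f_uniq) ?size_map ?size_tuple //.
  by rewrite !(nth_map 0) ?size_tuple ?fij.
by rewrite qE (big_nth 0) size_tuple big_mkord.
Qed.
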